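(* Every claw-free cubic graph $G$ admits a $(1,1,1,3)$-packing edge-coloring; that is, $E(G)$ can be partitioned into sets $E_1, E_2, E_3, E_4$ such that each of $E_1, E_2, E_3$ is a matching (any two distinct edges in the same set are at edge-distance at least $2$), and any two distinct edges of $E_4$ are at edge-distance at least $4$.
   Context: Graphs are finite and simple. A graph is claw-free if it contains no induced subgraph isomorphic to $K_{1,3}$; it is cubic if every vertex has degree $3$. The edge-distance between two edges of $G$ is their distance as vertices in the line graph of $G$. For a non-decreasing sequence of positive integers $S=(s_1,\dots,s_k)$, an $S$-packing edge-coloring of $G$ is a partition of $E(G)$ into sets $E_1,\dots,E_k$ such that for each $i$, any two distinct edges of $E_i$ have edge-distance at least $s_i+1$. *)

(* Defs.v *)
From mathcomp Require Import all_boot.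

Set Implicit Arguments.
Unset Strict Implicit.
Unset Printing Implicit Defensive.

Record sgraph := SGraph {
  vertex :> finType;
  adj : rel vertex;
  adj_sym : symmetric adj;
  adj_irrefl : irreflexive adj }.

Definition degree (G : sgraph) (v : G) : nat := #|[set w | adj v w]|.

Definition cubic (G : sgraph) : Prop := forall v : G, degree v = 3.

Section Induced.
Variables (G : sgraph) (A : {set G}).

Definition induced_adj : rel {x : G | x \in A} :=
  fun x y => adj (val x) (val y).

Lemma induced_adj_sym : symmetric induced_adj.
Proof. by move=> x y; exact: adj_sym. Qed.

Lemma induced_adj_irrefl : irreflexive induced_adj.
Proof. by move=> x; exact: adj_irrefl. Qed.

Definition induced : sgraph := SGraph induced_adj_sym induced_adj_irrefl.

End Induced.

Definition isomorphic (G H : sgraph) : Prop :=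
  exists2 f : G -> H, bijective f & forall x y, adj (f x) (f y) = adj x y.

Section CompleteBipartite.
Variables m n : nat.

Definition bipartite_adj : rel ('I_m + 'I_n)%type := fun x y =>
  match x, y with
  | inl _, inr _ | inr _, inl _ => true
  | _, _ => false
  end.

Lemma bipartite_adj_sym : symmetric bipartite_adj.
Proof. by case=> x [y|y]. Qed.

Lemma bipartite_adj_irrefl : irreflexive bipartite_adj.
Proof. by case. Qed.

Definition complete_bipartite : sgraph :=
  SGraph bipartite_adj_sym bipartite_adj_irrefl.

End CompleteBipartite.

Definition claw_free (G : sgraph) : Prop :=
  forall A : {set G}, ~ isomorphic (induced A) (complete_bipartite 1 3).

Section Distance.
Variable G : sgraph.

Definition walk (x y : G) (n : nat) : bool :=
  [exists p : n.-tuple G, path (@adj G) x p && (last x p == y)].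

(* [None] stands for an infinite distance. A shortest walk has fewer than
   #|G| steps, so the bounded search never fails when [x] and [y] are
   connected; see [distP]. *)
Definition dist (x y : G) : option nat :=
  if connect (@adj G) x y then Some (find (walk x y) (iota 0 #|G|)) else None.

Lemma walkP (x y : G) (n : nat) :
  reflect (exists p, [/\ size p = n, path (@adj G) x p & last x p = y])
          (walk x y n).
Proof.
apply: (iffP existsP) => [[p /andP[pp /eqP lp]]|[p [<- pp lp]]].
  by exists p; rewrite size_tuple.
by exists (in_tuple p); rewrite pp; apply/eqP.
Qed.

Lemma distP (x y : G) :
  match dist x y with
  | Some n => walk x y n /\ (forall m, walk x y m -> n <= m)
  | None => forall m, ~~ walk x y m
  end.
Proof.
rewrite /dist; case: (boolP (connect _ _ _)) => [xy|nxy]; last first.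
  move=> m; apply: contra nxy => /walkP[p [_ pp lp]].
  by apply/connectP; exists p.
have hw : has (walk x y) (iota 0 #|G|).
  move/connectP: xy => [p pp lp].
  case/shortenP: pp lp => p' pp' up' _ lp'.
  apply/hasP; exists (size p'); last by apply/walkP; exists p'.
  rewrite mem_iota /= add0n -[(size p').+1]/(size (x :: p')).
  by rewrite -(card_uniqP up') max_card.
have lt := hw; rewrite has_find size_iota in lt.
split=> [|m wm]; first by have := nth_find 0 hw; rewrite nth_iota.
rewrite leqNgt; apply/negP => mlt.
by have := before_find 0 mlt; rewrite nth_iota ?wm // (ltn_trans mlt).
Qed.

End Distance.

Definition at_least (d : nat) (o : option nat) : bool :=
  if o is Some n then d <= n else true.

Definition edges (G : sgraph) : {set {set G}} :=
  [set a | [exists x, [exists y, adj x y && (a == [set x; y])]]].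

Section LineGraph.
Variable G : sgraph.

Definition edge : finType := {a : {set G} | a \in edges G}.

Definition line_adj : rel edge :=
  fun a b => (a != b) && ~~ [disjoint val a & val b].

Lemma line_adj_sym : symmetric line_adj.
Proof. by move=> a b; rewrite /line_adj eq_sym disjoint_sym. Qed.

Lemma line_adj_irrefl : irreflexive line_adj.
Proof. by move=> a; rewrite /line_adj eqxx. Qed.

Definition line_graph : sgraph := SGraph line_adj_sym line_adj_irrefl.

Definition edge_dist (a b : edge) : option nat := @dist line_graph a b.

End LineGraph.

(* As usual for colorings, a color class [E i] may be empty. *)
Definition packing_edge_coloring (G : sgraph) (S : seq nat)
    (E : 'I_(size S) -> {set edge G}) : Prop :=
  [/\ \bigcup_i E i = [set: edge G],
      forall i j, i != j -> [disjoint E i & E j]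
    & forall i (a b : edge G), a \in E i -> b \in E i -> a != b ->
        at_least (nth 0 S i).+1 (edge_dist a b)].

Definition has_packing_edge_coloring (G : sgraph) (S : seq nat) : Prop :=
  exists E : 'I_(size S) -> {set edge G}, packing_edge_coloring E.

(* Main.v *)
Require Import Defs.
From mathcomp Require Import all_boot.

(** Every vertex of a claw-free cubic graph lies in a triangle, and the triangles
    group into K4's, diamonds and isolated triangles. Contract the isolated
    triangles: the edges lying in no triangle form a loopless multigraph of maximum
    degree three, hence are properly 4-colourable by a Kempe-chain argument
    (Shannon's bound), and an edge that meets a diamond can be coloured last and so
    avoids the fourth colour. Two disjoint edges of the contracted multigraph are at
    edge-distance at least four in the graph, because every passage through a
    triangle costs an extra edge; so the fourth class is sparse enough. Each
    triangle and K4 is then completed with the first three colours only, and each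
    diamond likewise, except possibly for its central edge, which is far from every
    other edge of the fourth class. *)

Set Implicit Arguments.
Unset Strict Implicit.
Unset Printing Implicit Defensive.

(** * Ends of simple paths in graphs of maximum degree two *)

Section Ends.
Variables (T : finType) (e : rel T).

(** Two simple paths with the same first step agree from then on, since a vertex of degree at most
    two has only one neighbour besides its predecessor [y]. If one path stopped earlier, its last
    vertex, being an end, would send the other path back to [y]. *)
Lemma uniq_paths_one_end y x p q :
    (forall x y1 y2 y3, e x y1 -> e x y2 -> e x y3 ->
       [\/ y1 = y2, y1 = y3 | y2 = y3]) ->
    e x y -> path e x p -> path e x q ->
    uniq (y :: x :: p) -> uniq (y :: x :: q) ->
    (forall z z', e (last x p) z -> e (last x p) z' -> z = z') ->
    (forall z z', e (last x q) z -> e (last x q) z' -> z = z') ->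
    symmetric e -> last x p = last x q.
Proof.
move=> deg2 exy + + + + endp endq symE.
elim: p q y x exy endp endq => [|a p IH] [|b q] y x exy endp endq //=.
- move=> _ /andP[exb _] _ /andP[].
  by rewrite (endp y b exy exb) !inE eqxx orbT.
- move=> /andP[exa _] _ /andP[].
  by rewrite (endq y a exy exa) !inE eqxx orbT.
move=> /andP[exa pp] /andP[exb pq] /andP[yp up] /andP[yq uq].
have eab : a = b.
  case: (deg2 x y a b exy exa exb) => // eq_y; move: yp yq.
    by rewrite eq_y !inE eqxx orbT.
  by rewrite eq_y !inE eqxx !orbT.
subst b; apply: (IH q x a) => //; first by rewrite symE.
Qed.

(* A connected graph of maximum degree two is a path or a cycle. *)
Lemma connect_three_ends u v w :
    symmetric e ->
    (forall x y1 y2 y3, e x y1 -> e x y2 -> e x y3 ->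
       [\/ y1 = y2, y1 = y3 | y2 = y3]) ->
    (forall y z, e u y -> e u z -> y = z) ->
    (forall y z, e v y -> e v z -> y = z) ->
    (forall y z, e w y -> e w z -> y = z) ->
    u != v -> u != w -> connect e u v -> connect e u w -> v = w.
Proof.
move=> symE deg2 endu endv endw nuv nuw /connectP[p0 pp0 lp0] /connectP[q0 pq0 lq0].
case/shortenP: pp0 lp0 => -[|a p] pp up _ lp; first by rewrite lp eqxx in nuv.
case/shortenP: pq0 lq0 => -[|b q] pq uq _ lq; first by rewrite lq eqxx in nuw.
move: pp pq => /= /andP[ea pp] /andP[eb pq]; have eab := endu _ _ ea eb; subst b.
move: lp lq endv endw => /= -> -> endv endw.
by apply: (uniq_paths_one_end deg2 _ pp pq up uq); rewrite // symE.
Qed.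
End Ends.

(** * Neighbourhoods in a claw-free cubic graph *)

Section Graph.
Variable G : sgraph.
Hypothesis hcubic : cubic G.
Hypothesis hclaw : claw_free G.
Implicit Types x y z v p q r : G.

(** Otherwise the four vertices induce $K_{1,3}$ with centre [v]; [f] is the explicit isomorphism,
    bijective by injectivity and a count. *)
Lemma claw_free_nbrs v p q r :
  adj v p -> adj v q -> adj v r -> uniq [:: p; q; r] ->
  [|| adj p q, adj p r | adj q r].
Proof.
move=> vp vq vr; rewrite /= !inE negb_or => /andP[/andP[pq pr]]/andP[qr _].
apply/negPn/negP; rewrite !negb_or => /and3P[npq npr nqr].
have nvx x : adj v x -> (x == v) = false.
  by apply: contraTF => /eqP ->; rewrite adj_irrefl.
pose A := [set x in [:: v; p; q; r]].
apply: (hclaw (A := A)).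
pose f (x : induced A) : complete_bipartite 1 3 :=
  if val x == v then inl ord0 else
  inr (if val x == p then inord 0 else if val x == q then inord 1 else inord 2).
have inA (x : induced A) : [\/ val x = v, val x = p, val x = q | val x = r].
  case: x => x /=; rewrite !inE => /or4P[] /eqP ->;
  by [constructor 1|constructor 2|constructor 3|constructor 4].
have I3 (i j : nat) : i < 3 -> j < 3 -> (inord i == inord j :> 'I_3) = (i == j).
  by move=> li lj; rewrite -val_eqE /= !inordK.
have [qp [rp rq]] : (q == p) = false /\ (r == p) = false /\ (r == q) = false.
  by rewrite [q == p]eq_sym [r == p]eq_sym [r == q]eq_sym; split; last split; apply: negbTE.
have fE : [/\ forall x : induced A, val x = v -> f x = inl ord0,
            forall x : induced A, val x = p -> f x = inr (inord 0),
            forall x : induced A, val x = q -> f x = inr (inord 1)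
          & forall x : induced A, val x = r -> f x = inr (inord 2)].
  by split=> x; rewrite /f => ->; rewrite ?eqxx ?nvx ?eqxx ?qp ?rp ?rq.
case: fE => fv fp fq fr.
have finj : injective f.
  move=> x y fxy; apply: val_inj; move: fxy.
  case: (inA x) => [/[dup] ex /fv fx|/[dup] ex /fp fx|/[dup] ex /fq fx|/[dup] ex /fr fx];
  case: (inA y) => [/[dup] ey /fv fy|/[dup] ey /fp fy|/[dup] ey /fq fy|/[dup] ey /fr fy];
  by rewrite fx fy ex ey // => -[/eqP]; rewrite I3.
exists f.
  apply: inj_card_bij => //.
  rewrite card_sum !card_ord card_sig -[X in _ <= X]cardsE.
  have -> : [set x | x \in A] = A by apply/setP=> x; rewrite inE.
  rewrite /A cardsE (card_uniqP _) //= !inE ![v == _]eq_sym !nvx //=.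
  by rewrite negb_or pq pr qr.
have adjC (a b : G) : ~~ adj a b -> adj a b = false /\ adj b a = false.
  by move=> /negbTE nab; rewrite [adj b a]adj_sym nab.
have [[h1 h2] [h3 h4] [h5 h6]] := And3 (adjC _ _ npq) (adjC _ _ npr) (adjC _ _ nqr).
move=> x y; have -> : @adj (induced A) x y = @adj G (val x) (val y) by [].
case: (inA x) => [/[dup] ex /fv fx|/[dup] ex /fp fx|/[dup] ex /fq fx|/[dup] ex /fr fx];
case: (inA y) => [/[dup] ey /fv fy|/[dup] ey /fp fy|/[dup] ey /fq fy|/[dup] ey /fr fy];
rewrite fx fy ex ey -[LHS]/(bipartite_adj _ _) [LHS]/=;
by rewrite ?adj_irrefl ?[adj _ v]adj_sym ?vp ?vq ?vr ?h1 ?h2 ?h3 ?h4 ?h5 ?h6.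
Qed.

Lemma adj_mem3 v p q r : adj v p -> adj v q -> adj v r -> uniq [:: p; q; r] ->
  forall y, adj v y = (y \in [:: p; q; r]).
Proof.
move=> vp vq vr u y.
have sub : [set w in [:: p; q; r]] \subset [set w | adj v w].
  by apply/subsetP=> w; rewrite !inE => /or3P[] /eqP->.
have /eqP/setP/(_ y) : [set w in [:: p; q; r]] == [set w | adj v w].
  by rewrite eqEcard sub -[X in X <= _]/(degree v) hcubic cardsE (card_uniqP u).
by rewrite in_set [RHS]in_set => ->.
Qed.

Lemma nbrs v : exists p q r,
  [/\ uniq [:: p; q; r], forall y, adj v y = (y \in [:: p; q; r]) & adj p q].
Proof.
have := hcubic v; rewrite /degree cardE.
case E: (enum _) => [|p [|q [|r [|]]]] // _.
have u : uniq [:: p; q; r] by rewrite -E enum_uniq.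
have aE y : adj v y = (y \in [:: p; q; r]) by rewrite -E mem_enum inE.
have [vp vq vr] : [/\ adj v p, adj v q & adj v r].
  by rewrite !aE !inE !eqxx !orbT.
have uE : uniq [:: p; r; q] && uniq [:: q; r; p].
  move: u; rewrite /= !inE !negb_or [r == q]eq_sym [q == p]eq_sym [r == p]eq_sym.
  by do 3 case: (_ == _).
case/andP: uE => u1 u2.
case/or3P: (claw_free_nbrs vp vq vr u) => h.
- by exists p, q, r.
- by exists p, r, q; split=> //; apply: adj_mem3.
- by exists q, r, p; split=> //; apply: adj_mem3.
Qed.

(** * Edges inside and outside triangles *)

Definition tri x y := adj x y && [exists z, adj x z && adj y z].
Definition ext x y := adj x y && ~~ tri x y.
Definition outer x := [exists y, ext x y].
(** The default [x] occurs exactly when every edge at [x] lies in a triangle. *)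
Definition mate x := odflt x [pick y | ext x y].
(** These are the tips of the diamonds: the vertices that are not [outer] turn out to be those of
    the K4's and the central vertices of the diamonds. *)
Definition diamond_end x := outer x && [exists z, tri x z && ~~ outer z].

Lemma tri_sym : symmetric tri.
Proof.
move=> x y; rewrite /tri adj_sym; congr andb.
by apply: eq_existsb => z; rewrite andbC.
Qed.

Lemma triW x y : tri x y -> adj x y. Proof. by case/andP. Qed.

Lemma tri_neq x y : tri x y -> x != y.
Proof. by case/andP=> + _; apply: contraTneq => ->; rewrite adj_irrefl. Qed.

Lemma triI x y z : adj x y -> adj x z -> adj y z -> tri x y.
Proof. by move=> xy xz yz; rewrite /tri xy; apply/existsP; exists z; rewrite xz. Qed.

Lemma adj_tri_ext x y : adj x y = tri x y || ext x y.
Proof. by rewrite /ext; case: (boolP (tri x y)) => [/triW ->|]; rewrite ?andbT. Qed.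

Lemma ext_sym : symmetric ext.
Proof. by move=> x y; rewrite /ext adj_sym tri_sym. Qed.

Lemma ext_triF x y : ext x y -> tri x y = false.
Proof. by case/andP=> _ /negbTE. Qed.

Lemma ext_mate x : outer x -> ext x (mate x).
Proof. by rewrite /mate => /existsP[y xy]; case: pickP => [//|/(_ y)]; rewrite xy. Qed.

Lemma ext_outer x y : ext x y -> outer x.
Proof. by move=> xy; apply/existsP; exists y. Qed.

(** Two of the three neighbours of [v] are adjacent, hence form a triangle with [v]; the mate can
    only be the third. *)
Lemma outer_nbrs v : outer v -> exists p q,
  [/\ p != q, tri p q, tri v p, tri v q
    & forall y, adj v y = [|| y == p, y == q | y == mate v]].
Proof.
move=> ov; have vm := ext_mate ov.
have [p [q [r [u vE pq]]]] := nbrs v.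
have [vp vq] : adj v p /\ adj v q by rewrite !vE !inE !eqxx orbT.
have tvp : tri v p by apply: triI pq.
have tvq : tri v q by apply: triI vp _; rewrite // adj_sym.
have em : mate v = r.
  have := vm; rewrite {1}/ext vE !inE => /andP[/or3P[] /eqP] //;
  by move=> -> /negP[].
exists p, q; split=> //; last by move=> y; rewrite vE !inE em.
  by move: u; rewrite /= !inE negb_or => /andP[/andP[]].
by apply: (@triI _ _ v); rewrite // adj_sym.
Qed.

(** The edges outside triangles thus form a matching of the graph. *)
Lemma ext_mateE x y : ext x y -> y = mate x.
Proof.
move=> xy; have [p [q [_ _ tp tq E]]] := outer_nbrs (ext_outer xy).
have := xy; rewrite /ext E => /andP[/or3P[]/eqP] // ->; by rewrite ?tp ?tq.
Qed.

Lemma mateK x : outer x -> mate (mate x) = x.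
Proof. by move=> /ext_mate; rewrite ext_sym => /ext_mateE. Qed.

Lemma outer_mate x : outer x -> outer (mate x).
Proof. by move=> /ext_mate; rewrite ext_sym; exact: ext_outer. Qed.

Lemma outer_tri_nbrs v : outer v -> exists p q,
  [/\ p != q, tri p q, tri v p, tri v q & forall y, tri v y = (y == p) || (y == q)].
Proof.
move=> ov; have [p [q [pq tpq vp vq E]]] := outer_nbrs ov.
exists p, q; split=> // y; apply/idP/orP => [ty|[]/eqP-> //].
have := triW ty; rewrite E => /or3P[->|->|/eqP ey]; [by left|by right|].
by rewrite ey (ext_triF (ext_mate ov)) in ty.
Qed.

Lemma tri_trans x y z : outer x -> tri x y -> tri x z -> y != z -> tri y z.
Proof.
move=> /outer_tri_nbrs[p [q [_ pq _ _ E]]]; rewrite !E.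
by move=> /orP[]/eqP-> /orP[]/eqP->; rewrite ?eqxx // tri_sym.
Qed.

Lemma inner_adj x y : ~~ outer x -> adj x y = tri x y.
Proof.
move=> ox; rewrite adj_tri_ext; case: (boolP (ext x y)) => [/ext_outer|]; last by rewrite orbF.
by rewrite (negbTE ox).
Qed.

(** All three edges at [v] lie in triangles, so its neighbourhood contains a path [a], [w], [d]. By
    degree three the middle vertex [w] is a twin of [v]: both have the same closed neighbourhood. *)
Lemma inner_nbrs v : ~~ outer v -> exists a w d,
  [/\ uniq [:: a; v; w; d], forall y, adj v y = (y \in [:: a; w; d]),
      forall y, adj w y = (y \in [:: a; v; d]) & ~~ outer w].
Proof.
move=> iv; have [p [q [r [u vE pq]]]] := nbrs v.
have [vp vq vr] : [/\ adj v p, adj v q & adj v r].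
  by rewrite !vE !inE !eqxx !orbT.
suff main a w d : adj v a -> adj v w -> adj v d -> uniq [:: a; w; d] ->
    adj a w -> adj w d -> exists a w d,
  [/\ uniq [:: a; v; w; d], forall y, adj v y = (y \in [:: a; w; d]),
      forall y, adj w y = (y \in [:: a; v; d]) & ~~ outer w].
  have := vr; rewrite inner_adj // => /andP[_ /existsP[s /andP[]]].
  rewrite vE !inE => /or3P[]/eqP-> rs; last by rewrite adj_irrefl in rs.
  - apply: (main q p r); rewrite // 1?adj_sym //.
    by move: u; rewrite /= !inE !negb_or [q == p]eq_sym => /andP[/andP[-> ->]]/andP[-> _].
  - by apply: (main p q r); rewrite // adj_sym.
move=> va vw vd /[dup] uawd; rewrite /= !inE !negb_or => /andP[/andP[naw nad]] /andP[nwd _] aw wd.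
have nv x : adj v x -> v != x by apply: contraTneq => <-; rewrite adj_irrefl.
have E1 := adj_mem3 va vw vd uawd.
have E2 : forall y, adj w y = (y \in [:: a; v; d]).
  apply: adj_mem3 => //; rewrite 1?adj_sym //.
  by rewrite /= !inE !negb_or nad nv // eq_sym nv.
exists a, w, d; split=> //.
  by rewrite /= !inE !negb_or naw nad nwd !nv // eq_sym nv.
apply/negP=> /existsP[y /andP[+ /negP[]]]; rewrite E2 !inE => /or3P[]/eqP->.
- by apply: (@triI _ _ v); rewrite // 1?[adj _ v]adj_sym // adj_sym.
- by apply: (@triI _ _ a); rewrite // 1?[adj w _]adj_sym.
- by apply: (@triI _ _ v); rewrite // 1?[adj _ v]adj_sym.
Qed.

(** The twin [w] of [z] is adjacent to [x] too, so the two triangle neighbours of [x] are [z] and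
    [w], and neither is outer. *)
Lemma tri_inner x y z : outer x -> tri x z -> ~~ outer z -> tri x y -> ~~ outer y.
Proof.
move=> ox xz iz xy.
have [a [w [d [u zE wE iw]]]] := inner_nbrs iz.
have [za zw zd] : [/\ adj z a, adj z w & adj z d] by rewrite !zE !inE !eqxx !orbT.
have [wa wz wd] : [/\ adj w a, adj w z & adj w d] by rewrite !wE !inE !eqxx !orbT.
have nzw : z != w by move: u; rewrite /= !inE !negb_or => /and3P[_ /andP[]].
have main : tri x w -> ~~ outer y.
  have [p [q [npq _ _ _ E]]] := outer_tri_nbrs ox.
  rewrite E; move: xz xy; rewrite !E.
  move=> /orP[]/eqP ez /orP[]/eqP ey /orP[]/eqP ew; move: nzw iz iw; rewrite ez ey ew ?eqxx //.
move: xz => /triW; rewrite adj_sym zE !inE => /or3P[]/eqP e.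
- by apply: main; rewrite e; apply: (@triI _ _ z); rewrite 1?adj_sym // wE inE eqxx.
- by move: ox; rewrite e (negbTE iw).
- by apply: main; rewrite e; apply: (@triI _ _ z); rewrite 1?adj_sym // wE inE eqxx.
Qed.

Lemma diamond_endP x y : diamond_end x -> tri x y -> ~~ outer y.
Proof. by move=> /andP[ox /existsP[z /andP[xz iz]]]; apply: tri_inner xz iz. Qed.

Lemma tri_outer x y : outer x -> ~~ diamond_end x -> tri x y -> outer y.
Proof.
move=> ox; rewrite /diamond_end ox /= => h xy; apply: contraR h => iy.
by apply/existsP; exists y; rewrite xy.
Qed.

(** * Edge colourings of the contracted multigraph *)

(* [top] is the sparse fourth colour. *)
Let color := (bool * bool)%type.
Let top : color := (true, true).
Implicit Types (c : G -> color) (S : {set G}).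

(* A colour on [x] stands for the colour of the edge outside triangles at [x]. *)
Definition mate_closed S := forall x, x \in S -> outer x /\ mate x \in S.

(** Two edges outside triangles meet in the contracted multigraph when they have ends in a common
    triangle, whence the condition on [tri]. The set [S] holds the ends of the edges under
    consideration. *)
Definition proper S c := forall x, x \in S ->
  c (mate x) = c x /\ forall y, y \in S -> tri x y -> c y != c x.

Definition recolor c x k := fun v => if (v == x) || (v == mate x) then k else c v.

Lemma mate_closedD S x : outer x -> mate_closed S ->
  mate_closed (S :\: [set x; mate x]).
Proof.
move=> ox cS y; rewrite !inE negb_or => /andP[/andP[nx nm] /cS[oy my]].
split=> //; rewrite my andbT negb_or.
apply/andP; split; first by apply: contraNneq nm => <-; rewrite mateK.
by apply: contraNneq nx => /(congr1 mate); rewrite !mateK // => ->.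
Qed.

Lemma proper_sub S S' c : S' \subset S -> proper S c -> proper S' c.
Proof.
move=> /subsetP sub pc x /sub /pc[mx tx]; split=> // y /sub; exact: tx.
Qed.

Lemma proper_recolor S x c k : mate_closed S -> x \in S ->
  proper (S :\: [set x; mate x]) c ->
  (forall y, y \in S -> tri x y -> c y != k) ->
  (forall y, y \in S -> tri (mate x) y -> c y != k) ->
  proper S (recolor c x k).
Proof.
move=> cS xS pc fx fm y yS; have [ox mS] := cS _ xS.
(* The contracted multigraph has no loops: an edge outside triangles never joins two triangle
   neighbours. *)
have nt : tri x (mate x) = false := ext_triF (ext_mate ox).
have nt' : tri (mate x) x = false by rewrite tri_sym.
have tNx z : tri z z = false by apply/negP=> /tri_neq; rewrite eqxx.
rewrite /recolor.
have [->|nyx] := eqVneq y x.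
  rewrite eqxx orbT; split=> // z zS xz.
  have [ezx|nzx] := eqVneq z x; first by rewrite ezx tNx in xz.
  have [ezm|nzm] := eqVneq z (mate x); first by rewrite ezm nt in xz.
  exact: fx.
have [->|nym] := eqVneq y (mate x).
  rewrite mateK // eqxx; split=> // z zS xz.
  have [ezx|nzx] := eqVneq z x; first by rewrite ezx nt' in xz.
  have [ezm|nzm] := eqVneq z (mate x); first by rewrite ezm tNx in xz.
  exact: fm.
have yS' : y \in S :\: [set x; mate x] by rewrite !inE negb_or nyx nym.
have [oy] := mate_closedD ox cS yS'.
rewrite !inE negb_or => /andP[/andP[/negbTE-> /negbTE->] _] /=.
have [-> ty] := pc _ yS'; split=> // z zS yz.
have [ezx|nzx] := eqVneq z x.
  by rewrite eq_sym; apply: fx => //; rewrite -ezx tri_sym.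
have [ezm|nzm] := eqVneq z (mate x).
  by rewrite eq_sym; apply: fm => //; rewrite -ezm tri_sym.
by apply: ty => //; rewrite !inE negb_or nzx nzm.
Qed.

(** * Kempe chains in two colours *)

Section Kempe.
Variables (S : {set G}) (c : G -> color) (a b : color).
Hypotheses (cS : mate_closed S) (pc : proper S c) (ab : a != b).

Let K : pred G := fun v => (v \in S) && ((c v == a) || (c v == b)).
(** Chains are followed through the vertices of the graph itself: an edge outside triangles has the
    same colour at both ends, and a triangle edge passes from one of [a], [b] to the other. *)
Definition kempe : rel G := fun x y => [&& K x, K y & adj x y].

Lemma kempe_sym : symmetric kempe.
Proof. by move=> x y; rewrite /kempe adj_sym andbCA. Qed.

Lemma kempe_mate x : K x -> kempe x (mate x).
Proof.
move=> /[dup] Kx /andP[xS cx]; have [ox mS] := cS xS; have [cm _] := pc xS.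
by rewrite /kempe Kx /K mS cm cx; have /andP[] := ext_mate ox.
Qed.

Lemma kempe_tri x y : kempe x y -> y = mate x \/
  [/\ tri x y, y \in S & c y = if c x == a then b else a].
Proof.
move=> /and3P[/andP[xS cx] /andP[yS cy] xy]; move: xy; rewrite adj_tri_ext.
case/orP=> [txy|]; last by move/ext_mateE; left.
right; split=> //; have [_ /(_ y yS txy)] := pc xS.
by move: cx cy => /orP[] /eqP -> /orP[] /eqP ->; rewrite ?eqxx // [b == a]eq_sym (negbTE ab).
Qed.

(** Besides the mate there is at most one neighbour: two triangle neighbours of [x] in the chain
    would carry the same colour, yet they are adjacent in the triangle of [x]. *)
Lemma kempe_deg2 x y1 y2 y3 : kempe x y1 -> kempe x y2 -> kempe x y3 ->
  [\/ y1 = y2, y1 = y3 | y2 = y3].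
Proof.
have main y z : kempe x y -> kempe x z -> [\/ y = mate x, z = mate x | y = z].
  move=> /[dup] /and3P[/andP[xS _] _ _].
  move=> /kempe_tri[|[xy yS cy]]; first by constructor 1.
  move=> /kempe_tri[|[xz zS cz]]; first by constructor 2.
  have [|nyz] := eqVneq y z; first by constructor 3.
  have yz := tri_trans (proj1 (cS xS)) xy xz nyz.
  by have [_ /(_ z zS yz)] := pc yS; rewrite cy cz eqxx.
move=> h1 h2 h3; case: (main _ _ h1 h2) (main _ _ h1 h3) (main _ _ h2 h3) => e1.
- by case=> e2; case=> e3; subst; by [constructor 1|constructor 2|constructor 3].
- by case=> e2; case=> e3; subst; by [constructor 1|constructor 2|constructor 3].
- by constructor 1.
Qed.

Lemma kempe_end x : (forall y, y \in S -> tri x y -> ~~ ((c y == a) || (c y == b))) ->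
  forall y z, kempe x y -> kempe x z -> y = z.
Proof.
move=> nx; have main y : kempe x y -> y = mate x.
  move=> /[dup] /and3P[_ /andP[yS cy] _] /kempe_tri[//|[xy _ _]].
  by have := nx _ yS xy; rewrite cy.
by move=> y z /main -> /main ->.
Qed.

Definition kempe_swap x v :=
  if K v && connect kempe x v then (if c v == a then b else a) else c v.

(** A swap could only create a conflict between two vertices of colours [a] and [b] in one triangle,
    but these lie in the same component and are exchanged together. *)
Lemma kempe_swap_proper x : proper S (kempe_swap x).
Proof.
have conn y z : kempe y z -> connect kempe x y = connect kempe x z.
  move=> yz; apply/idP/idP => h; apply: connect_trans h (connect1 _) => //.
  by rewrite kempe_sym.
move=> y yS; have [oy mS] := cS yS; have [cm ty] := pc yS; split.
  have Km : K (mate y) = K y by rewrite /K mS yS cm.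
  rewrite /kempe_swap Km cm; case: (boolP (K y)) => //= Ky.
  by rewrite (conn _ _ (kempe_mate Ky)).
move=> z zS yz; have nyz := ty z zS yz; rewrite /kempe_swap.
have [Ky|nKy] := boolP (K y); have [Kz|nKz] := boolP (K z) => //=.
- have kyz : kempe y z by rewrite /kempe Ky Kz triW.
  rewrite (conn _ _ kyz); case: connect => //.
  move: Ky Kz nyz => /andP[_ /orP[]/eqP->] /andP[_ /orP[]/eqP->];
  by rewrite ?eqxx // [b == a]eq_sym (negbTE ab) // eq_sym.
- case: connect => //; move: nKz; rewrite /K zS /= negb_or => /andP[na nb].
  by case: ifP => _.
- case: connect => //; move: nKy; rewrite /K yS /= negb_or => /andP[na nb].
  by case: ifP => _; rewrite eq_sym.
Qed.

Lemma kempe_swap_id x v : ~~ connect kempe x v -> kempe_swap x v = c v.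
Proof. by rewrite /kempe_swap => /negbTE->; rewrite andbF. Qed.

Lemma kempe_swap_other x v : c v != a -> c v != b -> kempe_swap x v = c v.
Proof. by rewrite /kempe_swap /K => /negbTE-> /negbTE->; rewrite andbF. Qed.

Lemma kempe_swap_self x : x \in S -> c x = a -> kempe_swap x x = b.
Proof. by rewrite /kempe_swap /K => -> ->; rewrite eqxx connect0. Qed.
End Kempe.

(** * Shannon's bound with four colours *)

Lemma color_avoid3 (k1 k2 k3 : color) : exists k, [/\ k1 != k, k2 != k & k3 != k].
Proof.
by case: k1 k2 k3 => [[] []] [[] []] [[] []];
 do [by exists (true, true)|by exists (true, false)|by exists (false, true)
    |by exists (false, false)].
Qed.

Lemma color_avoid4 (k1 k2 k3 k4 : color) :
  uniq [:: k1; k2; k3; k4] \/ exists k, [/\ k1 != k, k2 != k, k3 != k & k4 != k].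
Proof.
by case: k1 k2 k3 k4 => [[] []] [[] []] [[] []] [[] []];
 do [by left|right; by exists (true, true)|right; by exists (true, false)
    |right; by exists (false, true)|right; by exists (false, false)].
Qed.

(** One uncoloured edge, from [x] to its mate, is added. At most four coloured edges meet it, at [p]
    and [q] on one side and at [p'] and [q'] on the other; the work lies in the case where these
    carry all four colours. *)
Lemma proper_extend S x c : mate_closed S -> x \in S ->
  proper (S :\: [set x; mate x]) c -> exists c', proper S c'.
Proof.
set S' := _ :\: _ => cS xS pc; have [ox mS] := cS _ xS.
have om := outer_mate ox; have cS' : mate_closed S' := mate_closedD ox cS.
have [p [q [npq tpq xp xq xE]]] := outer_tri_nbrs ox.
have [p' [q' [npq' tpq' mp mq mE]]] := outer_tri_nbrs om.
have direct c1 k : proper S' c1 -> (p \in S -> c1 p != k) -> (q \in S -> c1 q != k) ->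
    (p' \in S -> c1 p' != k) -> (q' \in S -> c1 q' != k) -> exists c', proper S c'.
  move=> pc1 hp hq hp' hq'; exists (recolor c1 x k).
  apply: proper_recolor => // y yS; first by rewrite xE => /orP[]/eqP E; subst y; auto.
  by rewrite mE => /orP[]/eqP E; subst y; auto.
have [pS|npS] := boolP (p \in S); last first.
  have [k [h1 h2 h3]] := color_avoid3 (c q) (c p') (c q').
  by apply: (direct c k) => // pS; rewrite pS in npS.
have [qS|nqS] := boolP (q \in S); last first.
  have [k [h1 h2 h3]] := color_avoid3 (c p) (c p') (c q').
  by apply: (direct c k) => // qS; rewrite qS in nqS.
have [p'S|np'S] := boolP (p' \in S); last first.
  have [k [h1 h2 h3]] := color_avoid3 (c p) (c q) (c q').
  by apply: (direct c k) => // p'S; rewrite p'S in np'S.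
have [q'S|nq'S] := boolP (q' \in S); last first.
  have [k [h1 h2 h3]] := color_avoid3 (c p) (c q) (c p').
  by apply: (direct c k) => // q'S; rewrite q'S in nq'S.
have [|[k [h1 h2 h3 h4]]] := color_avoid4 (c p) (c q) (c p') (c q'); last first.
  exact: (direct c k).
rewrite /= !inE !negb_or.
move=> /andP[/and3P[cpq cpp cpq']] /andP[/andP[cqp cqq]] /andP[cpq'' _].
have inS' y : y \in S -> tri x y \/ tri (mate x) y -> y \in S'.
  move=> yS h; rewrite !inE yS andbT negb_or; case: h => t.
    rewrite eq_sym (tri_neq t) /=; apply: contraTneq t => ->.
    by rewrite (ext_triF (ext_mate ox)).
  rewrite [y == mate x]eq_sym (tri_neq t) andbT; apply: contraTneq t => ->.
  by rewrite tri_sym (ext_triF (ext_mate ox)).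
have [pS' qS'] : p \in S' /\ q \in S' by split; apply: inS'; auto.
have [p'S' q'S'] : p' \in S' /\ q' \in S' by split; apply: inS'; auto.
have nx y : y \in S' -> y != x by rewrite !inE negb_or => /andP[/andP[]].
have nm y : y \in S' -> y != mate x by rewrite !inE negb_or => /andP[/andP[]].
have [op zS'] := cS' _ pS'; have [oq _] := cS' _ qS'.
have [op' _] := cS' _ p'S'; have [oq' _] := cS' _ q'S'.
set z := mate p in zS'; have oz : outer z := outer_mate op.
have [cz _] := pc _ pS'; rewrite -/z in cz.
have pnbr y : y \in S' -> tri p y -> y = q.
  move=> yS' py; have nxy : x != y by rewrite eq_sym nx.
  have px : tri p x by rewrite tri_sym.
  have := tri_trans op px py nxy; rewrite xE => /orP[]/eqP // E.
  by move: (tri_neq py); rewrite E eqxx.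
have qnbr y : y \in S' -> tri q y -> y = p.
  move=> yS' py; have nxy : x != y by rewrite eq_sym nx.
  have qx : tri q x by rewrite tri_sym.
  have := tri_trans oq qx py nxy; rewrite xE => /orP[]/eqP // E.
  by move: (tri_neq py); rewrite E eqxx.
have p'nbr y : y \in S' -> tri p' y -> y = q'.
  move=> yS' py; have nxy : mate x != y by rewrite eq_sym nm.
  have px : tri p' (mate x) by rewrite tri_sym.
  have := tri_trans op' px py nxy; rewrite mE => /orP[]/eqP // E.
  by move: (tri_neq py); rewrite E eqxx.
(* moving colour [c p] from the edge at [p] to the uncoloured edge at [x] *)
have shift c1 k : proper S' c1 -> c1 q != k ->
    (forall y, y \in S' -> tri z y -> c1 y != k) -> k != c p ->
    c1 q != c p -> c1 p' != c p -> c1 q' != c p -> exists c', proper S c'.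
  move=> pc1 qk zk kp h1 h2 h3.
  have pc2 : proper S' (recolor c1 p k).
    apply: proper_recolor => //; last by move=> y /pnbr h /h ->.
    by apply: proper_sub pc1; apply: subsetDl.
  by apply: (direct _ (c p) pc2) => _; rewrite /recolor ?eqxx //; case: ifP.
(* The colours [c p'] and [c q'] are candidates for recolouring the edge from [p] to [z]. If either
   is missing at the triangle of [z], shifting finishes; otherwise both occur there, at [y1] and
   [y2]. *)
have [|nz1] := boolP [exists y in S', tri z y && (c y == c p')]; last first.
  apply: (shift c (c p')) => //; rewrite 1?eq_sym // => y yS' zy.
  apply: contra nz1 => cy; apply/existsP; exists y.
  by rewrite yS' zy.
move=> /existsP[y1 /and3P[y1S' zy1 /eqP cy1]].
have [|nz2] := boolP [exists y in S', tri z y && (c y == c q')]; last first.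
  apply: (shift c (c q')) => //; rewrite 1?eq_sym // => y yS' zy.
  apply: contra nz2 => cy; apply/existsP; exists y.
  by rewrite yS' zy.
move=> /existsP[y2 /and3P[y2S' zy2 /eqP cy2]].
have ny12 : y1 != y2 by apply: contraNneq cpq'' => e; rewrite -cy1 -cy2 e.
have znbr y : tri z y -> y = y1 \/ y = y2.
  have [z1 [z2 [_ _ _ _ zE]]] := outer_tri_nbrs oz.
  move: zy1 zy2 ny12; rewrite !zE.
  by move=> /orP[]/eqP-> /orP[]/eqP->; rewrite ?eqxx // => _ /orP[]/eqP->; auto.
have [oy1 _] := cS' _ y1S'.
(* In these two colours [q], [p'] and [y1] are all chain ends: the other coloured vertices of their
   triangles carry only the colours [c p] and [c q']. *)
pose a := c p'; pose b := c q.
have ab : a != b by rewrite eq_sym.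
have notab u : c u = c p \/ c u = c q' -> ~~ ((c u == a) || (c u == b)).
  case=> ->; rewrite negb_or /a /b; first by rewrite cpp cpq.
  by rewrite eq_sym cpq'' eq_sym cqq.
have other x0 u : c u = c p \/ c u = c q' -> kempe_swap S' c a b x0 u = c u.
  by move=> /notab; rewrite negb_or => /andP[]; apply: kempe_swap_other.
have endq : forall y w, kempe S' c a b q y -> kempe S' c a b q w -> y = w.
  by apply: kempe_end => // y yS' /(qnbr _ yS') ->; apply: notab; left.
have endp' : forall y w, kempe S' c a b p' y -> kempe S' c a b p' w -> y = w.
  by apply: kempe_end => // y yS' /(p'nbr _ yS') ->; apply: notab; right.
have endy1 : forall y w, kempe S' c a b y1 y -> kempe S' c a b y1 w -> y = w.
  apply: kempe_end => // y yS' y1y; apply: notab.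
  have [->|nyz] := eqVneq y z; first by left.
  have : tri z y by apply: (@tri_trans y1); rewrite // 1?tri_sym 1?eq_sym.
  case/znbr=> e; last by right; rewrite e.
  by move: (tri_neq y1y); rewrite e eqxx.
have sK := kempe_sym S' c a b.
have sC := sym_connect_sym sK.
have np'y1 : p' != y1.
  apply: contraTneq zy1 => <-; rewrite tri_sym; apply/negP=> /(p'nbr _ zS') e.
  by move: cpq'; rewrite -cz e eqxx.
have nqp' : q != p' by apply: contraNneq cqp => ->.
have nqy1 : q != y1 by apply: contraNneq cqp => ->; rewrite cy1.
(* The three ends cannot all lie on one chain. If [q] and [p'] are joined, a swap at [y1] frees [a]
   at [z] without touching [q] or [p']; the edge at [p] takes [a] and gives up its colour to the
   edge at [x]. *)
have [conn|nconn] := boolP (connect (kempe S' c a b) q p').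
  have nc : ~~ connect (kempe S' c a b) q y1.
    apply: contraNN np'y1 => conn1; apply/eqP.
    by apply: (connect_three_ends sK (kempe_deg2 cS' pc ab) endq endp' endy1).
  have nc' : ~~ connect (kempe S' c a b) y1 p'.
    apply: contraNN nc => h; apply: connect_trans conn _; by rewrite sC.
  have pc1 := kempe_swap_proper cS' pc ab y1.
  have nc1 : ~~ connect (kempe S' c a b) y1 q by rewrite sC.
  apply: (shift _ a pc1).
  - by rewrite kempe_swap_id.
  - move=> y yS' /znbr[]->; first by rewrite kempe_swap_self // eq_sym.
    by rewrite other ?cy2 1?eq_sym; auto.
  - by rewrite eq_sym.
  - by rewrite kempe_swap_id // eq_sym.
  - by rewrite kempe_swap_id // eq_sym.
  - by rewrite other 1?eq_sym; auto.
(* Otherwise a swap at [p'] turns its colour into [b] and leaves [q] alone, so [a] becomes free for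
   the edge at [x]. *)
have pc1 := kempe_swap_proper cS' pc ab p'.
apply: (direct _ a pc1) => _.
- by rewrite other //; left.
- by rewrite kempe_swap_id // sC.
- by rewrite kempe_swap_self // eq_sym.
- by rewrite other 1?eq_sym //; right.
Qed.

Lemma color_avoid_top (k1 k2 : color) : exists k, [/\ k1 != k, k2 != k & k != top].
Proof.
by case: k1 k2 => [[] []] [[] []];
 do [by exists (true, false)|by exists (false, true)|by exists (false, false)].
Qed.

(** Edges at diamond tips are removed first, hence coloured last. A tip has no outer triangle
    neighbour, so only the two constraints at its mate remain, and one of the three colours other
    than [top] is available. *)
Lemma proper_exists S : mate_closed S -> exists2 c, proper S c &
  forall x, x \in S -> diamond_end x || diamond_end (mate x) -> c x != top.
Proof.
have [n] := ubnP #|S|; elim: n S => // n IH S ltSn cS.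
have IHx x : x \in S -> exists2 c, proper (S :\: [set x; mate x]) c &
    forall y, y \in S :\: [set x; mate x] ->
      diamond_end y || diamond_end (mate y) -> c y != top.
  move=> xS; apply: IH; last by apply: mate_closedD => //; case: (cS _ xS).
  have : S :\: [set x; mate x] \proper S.
    by apply/properP; split; [apply: subsetDl|exists x; rewrite ?inE ?eqxx].
  by move/proper_card => h; apply: leq_trans h _.
have [/existsP[x /andP[xS dx]]|nd] := boolP [exists x in S, diamond_end x].
  have [c pc dc] := IHx x xS; have [ox mS] := cS _ xS.
  have [p [q [_ _ _ _ mE]]] := outer_tri_nbrs (outer_mate ox).
  have [k [hp hq kt]] := color_avoid_top (c p) (c q).
  exists (recolor c x k).
    apply: proper_recolor => // y yS; last by rewrite mE => /orP[]/eqP->.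
    by move=> /(diamond_endP dx); have [-> _] := cS _ yS.
  move=> y yS dy; rewrite /recolor; case: ifP => // /negbT h.
  by apply: dc => //; rewrite !inE h.
(* With no diamond tip left in [S] the condition on [top] is vacuous, so Kempe swaps may recolour
   freely. *)
have [e|[x xS]] := set_0Vmem S.
  by exists (fun=> top) => [x|x]; rewrite e inE.
have [c pc _] := IHx x xS; have [c' pc'] := proper_extend cS xS pc.
exists c' => // y yS /orP[]d; case/negP: nd; apply/existsP.
  by exists y; rewrite yS.
by exists (mate y); rewrite d; have [_ ->] := cS _ yS.
Qed.

(** * Completing single blocks: K4's, diamonds and isolated triangles *)

Lemma outer_triE v p q : outer v -> tri v p -> tri v q -> p != q ->
  forall y, tri v y = (y \in [:: p; q]).
Proof.
move=> /outer_tri_nbrs[p0 [q0 [_ _ _ _ E]]] + + + y; rewrite !E !inE.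
by move=> /orP[]/eqP-> /orP[]/eqP->; rewrite ?eqxx // orbC.
Qed.

(** With [w] the twin of [v] and [a], [d] their common neighbours, the two cases are whether [a] and
    [d] are adjacent. *)
Lemma K4_or_diamond v : ~~ outer v -> exists a w d,
  [/\ uniq [:: a; v; w; d], forall y, tri v y = (y \in [:: a; w; d]),
      forall y, tri w y = (y \in [:: a; v; d]), ~~ outer w
    & [/\ ~~ outer a, ~~ outer d, forall y, tri a y = (y \in [:: v; w; d])
        & forall y, tri d y = (y \in [:: a; v; w])] \/
      [/\ outer a, outer d, forall y, tri a y = (y \in [:: v; w])
        & forall y, tri d y = (y \in [:: v; w])]].
Proof.
move=> iv; have [a [w [d [u vE wE iw]]]] := inner_nbrs iv.
have [va vw vd] : [/\ adj v a, adj v w & adj v d] by rewrite !vE !inE !eqxx !orbT.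
have [wa wv wd] : [/\ adj w a, adj w v & adj w d] by rewrite !wE !inE !eqxx !orbT.
have : [&& a != v, a != w, a != d, v != w, v != d & w != d].
  by move: u; rewrite /= !inE !negb_or -!andbA andbT.
case/and5P=> nav naw nad nvw /andP[nvd nwd].
have [av aw dv dw] : [/\ adj a v, adj a w, adj d v & adj d w].
  by rewrite ![adj a _]adj_sym ![adj d _]adj_sym.
exists a, w, d; split=> //; [by move=> y; rewrite -inner_adj|by move=> y; rewrite -inner_adj|].
have [ad|nad'] := boolP (adj a d).
  have da : adj d a by rewrite adj_sym.
  have aE : forall y, adj a y = (y \in [:: v; w; d]).
    by apply: adj_mem3 => //; rewrite /= !inE negb_or nvw nvd nwd.
  have dE : forall y, adj d y = (y \in [:: a; v; w]).
    by apply: adj_mem3 => //; rewrite /= !inE negb_or nav naw nvw.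
  have ia : ~~ outer a.
    apply/negP=> /existsP[y /andP[+ /negP[]]]; rewrite aE !inE => /or3P[]/eqP->.
    - exact: triI vw.
    - exact: triI wv.
    - exact: triI dv.
  have id : ~~ outer d.
    apply/negP=> /existsP[y /andP[+ /negP[]]]; rewrite dE !inE => /or3P[]/eqP->.
    - exact: triI av.
    - exact: triI va.
    - exact: triI wa.
  by left; split=> // y; rewrite -inner_adj.
(* The third edge at the tip [s] lies in no triangle: the third vertex would be [v] or [w], whose
   remaining neighbours are only [s] and [t]. *)
have end_outer s t : adj s v -> adj s w -> ~~ adj s t -> s != t ->
    (forall y, adj v y -> y != w -> y = s \/ y = t) ->
    (forall y, adj w y -> y != v -> y = s \/ y = t) -> outer s.
  move=> sv sw st nst vst wst.
  have [y [sy nyv nyw]] : exists y, [/\ adj s y, y != v & y != w].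
    have /subsetPn[y] : ~~ ([set y | adj s y] \subset [set v; w]).
      apply/negP=> /subset_leq_card; rewrite -[X in X <= _]/(degree s) hcubic.
      by rewrite cards2 nvw.
    by rewrite !inE negb_or => sy /andP[]; exists y.
  apply/existsP; exists y; rewrite /ext sy; apply/negP=> /andP[_ /existsP[z /andP[sz yz]]].
  have nys : y != s by apply: contraTneq sy => ->; rewrite adj_irrefl.
  have main : y = s \/ y = t -> False.
    by case=> e; [rewrite e eqxx in nys|rewrite -e sy in st].
  have [ez|nzv] := eqVneq z v.
    by apply: main; apply: vst => //; rewrite adj_sym -ez.
  have [ez|nzw] := eqVneq z w.
    by apply: main; apply: wst => //; rewrite adj_sym -ez.
  have us : uniq [:: v; w; y].
    by rewrite /= !inE negb_or nvw [v == y]eq_sym [w == y]eq_sym nyv nyw.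
  move: sz; rewrite (adj_mem3 sv sw sy us) !inE (negbTE nzv) (negbTE nzw) /=.
  by move=> /eqP ez; rewrite ez adj_irrefl in yz.
have oa : outer a.
  apply: (end_outer a d) => // y; rewrite ?vE ?wE !inE => /or3P[]/eqP->; auto;
  by rewrite eqxx.
have od : outer d.
  apply: (end_outer d a) => //; rewrite 1?adj_sym // 1?eq_sym // => y;
  rewrite ?vE ?wE !inE => /or3P[]/eqP->; auto; by rewrite eqxx.
right; split=> //; apply: outer_triE => //.
- exact: triI vw.
- exact: triI wv.
- exact: triI vw.
- exact: triI wv.
Qed.

(** This is $k + l + \mathtt{top}$ in $(\mathbb{Z}/2)^2$. As the four colours sum to zero, it is the
    remaining colour when [k], [l] and [top] are distinct. *)
Definition third (k l : color) : color := (~~ (k.1 (+) l.1), ~~ (k.2 (+) l.2)).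

(** Each side receives the outer colour of the opposite vertex, unless that is [top], which is
    replaced by the remaining colour. *)
Lemma triangle_colors (k1 k2 k3 : color) : uniq [:: k1; k2; k3] ->
  exists l12 l13 l23, [/\ uniq [:: l12; l13; l23; top], l12 \notin [:: k1; k2],
    l13 \notin [:: k1; k3] & l23 \notin [:: k2; k3]].
Proof.
exists (if k3 == top then third k1 k2 else k3),
       (if k2 == top then third k1 k3 else k2),
       (if k1 == top then third k2 k3 else k1).
by move: k1 k2 k3 H => [[] []] [[] []] [[] []].
Qed.

(** Here [a] and [d] are the tips and [bc] is the central edge. For equal tip colours the outer
    4-cycle alternates between the two other colours and [bc] repeats the tip colour; for different
    ones, [top] goes on [bc]. *)
Lemma diamond_colors (ka kd : color) : ka != top -> kd != top ->
  exists ab ac bc bd cd, [/\ uniq [:: ka; ab; ac; top], uniq [:: kd; bd; cd; top],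
    uniq [:: ab; bc; bd] & uniq [:: ac; bc; cd]].
Proof.
move=> ha hd; pose o := if ka == (false, false) then (false, true) else (false, false).
exists (if ka == kd then o else kd),
       (if ka == kd then third ka o else third ka kd),
       (if ka == kd then ka else top),
       (if ka == kd then third ka o else third ka kd),
       (if ka == kd then o else ka).
by rewrite /o; move: ka kd ha hd {o} => [[] []] [[] []].
Qed.

(** * Gluing the block colourings to the colouring of the edges outside triangles *)

Section Coloring.
Variable c : G -> color.
Hypothesis pc : proper [set x | outer x] c.
Hypothesis dc : forall x, outer x -> diamond_end x || diamond_end (mate x) -> c x != top.

(** The set [B] is to contain a whole block, being closed under [tri]. The last clause, with the
    symmetry of [f], allows [top] on at most one edge of [B]. *)
Definition local_coloring (B : {set G}) (f : G -> G -> color) :=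
  [/\ forall v u, v \in B -> tri v u ->
        [/\ u \in B, f u v = f v u & outer v -> f v u != c v /\ f v u != top],
      forall v u w, v \in B -> tri v u -> tri v w -> u != w -> f v u != f v w
    & forall v u v' u', v \in B -> v' \in B -> tri v u -> tri v' u' ->
        f v u = top -> f v' u' = top -> v' = v \/ v' = u].

Lemma local_inner v : ~~ outer v -> exists (B : {set G}) f, v \in B /\ local_coloring B f.
Proof.
move=> iv; have [a [w [d [u vE wE iw ad]]]] := K4_or_diamond iv.
have [ia iv' iw' id] : [/\ index a [:: a; v; w; d] = 0, index v [:: a; v; w; d] = 1,
    index w [:: a; v; w; d] = 2 & index d [:: a; v; w; d] = 3].
  have ind n := @index_uniq _ a n [:: a; v; w; d] ^~ u.
  by split; [exact: (ind 0)|exact: (ind 1)|exact: (ind 2)|exact: (ind 3)].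
pose B := [set x in [:: a; v; w; d]].
pose f (M : nat -> nat -> color) x y := M (index x [:: a; v; w; d]) (index y [:: a; v; w; d]).
have inB : [/\ a \in B, v \in B, w \in B & d \in B] by rewrite !inE !eqxx !orbT.
case: inB => aB vB wB dB.
case: ad => [[ia' id' aE dE]|[oa od aE dE]].
  (* The three perfect matchings of K4 receive the three colours other than [top]. *)
  pose M i j : color := match i, j with
    | 0, 1 | 1, 0 | 2, 3 | 3, 2 => (false, false)
    | 0, 2 | 2, 0 | 1, 3 | 3, 1 => (false, true)
    | _, _ => (true, false) end.
  exists B, (f M); split=> //; split.
  - move=> x y; rewrite inE !in_cons orbF => /or4P[]/eqP->;
    rewrite ?aE ?vE ?wE ?dE !in_cons orbF => /or3P[]/eqP->; split=> //;
    by rewrite /f ?ia ?iv' ?iw' ?id // => h; move: h ia' iv iw id' => ->.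
  - move=> x y z; rewrite inE !in_cons orbF => /or4P[]/eqP->;
    rewrite ?aE ?vE ?wE ?dE !in_cons !orbF => /or3P[]/eqP-> /or3P[]/eqP->;
    by rewrite ?eqxx // /f ?ia ?iv' ?iw' ?id.
  - move=> x y z t; rewrite inE !in_cons orbF => /or4P[]/eqP-> _;
    rewrite ?aE ?vE ?wE ?dE !in_cons !orbF => /or3P[]/eqP-> _;
    by rewrite /f ?ia ?iv' ?iw' ?id.
have endF x : outer x -> tri x v -> c x != top.
  move=> ox xv; apply: dc; rewrite // /diamond_end ox; apply/orP; left.
  by apply/existsP; exists v; rewrite xv.
have [||ab [ac [bc [bd [cd]]]]] := @diamond_colors (c a) (c d).
- by apply: endF; rewrite // aE inE eqxx.
- by apply: endF; rewrite // dE inE eqxx.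
case; rewrite /= !inE !negb_or !andbT.
move=> /andP[/and3P[h1 h2 _]] /andP[/andP[h3 h4] h5].
move=> /andP[/and3P[h6 h7 _]] /andP[/andP[h8 h9] h10].
move=> /andP[/andP[h11 h12] h13] /andP[/andP[h14 h15] h16].
(* Among the edges of the diamond, the default value [bc] is reached only by the central one. *)
pose M i j : color := match i, j with
  | 0, 1 | 1, 0 => ab | 0, 2 | 2, 0 => ac | 1, 3 | 3, 1 => bd | 2, 3 | 3, 2 => cd
  | _, _ => bc end.
exists B, (f M); split=> //; split.
- move=> x y; rewrite inE !in_cons orbF => /or4P[]/eqP->;
  rewrite ?aE ?vE ?wE ?dE !in_cons !orbF => h;
  repeat (case/orP: h => h); move/eqP: h => ->; split=> //;
  rewrite /f ?ia ?iv' ?iw' ?id ?(negbTE iv) ?(negbTE iw) //= => _;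
  by rewrite eq_sym.
- move=> x y z; rewrite inE !in_cons orbF => /or4P[]/eqP->;
  rewrite ?aE ?vE ?wE ?dE !in_cons !orbF => h h';
  repeat (case/orP: h => h); move/eqP: h => ->;
  repeat (case/orP: h' => h'); move/eqP: h' => ->;
  rewrite ?eqxx // /f ?ia ?iv' ?iw' ?id //= => _; by rewrite // eq_sym.
- have main x y : x \in B -> tri x y -> f M x y = top ->
      x = v /\ y = w \/ x = w /\ y = v.
    rewrite inE !in_cons orbF => /or4P[]/eqP->;
    rewrite ?aE ?vE ?wE ?dE !in_cons !orbF => h;
    repeat (case/orP: h => h); move/eqP: h => ->;
    rewrite /f ?ia ?iv' ?iw' ?id /=; auto => /eqP;
    by rewrite ?(negbTE h4) ?(negbTE h5) ?(negbTE h9) ?(negbTE h10).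
  move=> x y x' y' xB x'B t t' e e'.
  by case: (main _ _ xB t e) (main _ _ x'B t' e') => -[-> ->] [] [-> _]; auto.
Qed.

(** A diamond tip borrows the block of its inner neighbour; any other outer vertex lies in a
    triangle of three outer vertices, where [top] is avoided altogether. *)
Lemma local_exists x : exists (B : {set G}) f, x \in B /\ local_coloring B f.
Proof.
have [ox|] := boolP (outer x); last exact: local_inner.
have [/andP[_ /existsP[z /andP[xz iz]]]|nd] := boolP (diamond_end x).
  have [B [f [zB lB]]] := local_inner iz; exists B, f; split=> //.
  by case: lB => [/(_ z x zB)[]] //; rewrite tri_sym.
have [y [z [nyz tyz xy xz xE]]] := outer_tri_nbrs ox.
have oy := tri_outer ox nd xy; have oz := tri_outer ox nd xz.
have xE' := outer_triE ox xy xz nyz.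
have yE : forall t, tri y t = (t \in [:: x; z]).
  by apply: outer_triE; rewrite // 1?tri_sym // tri_neq.
have zE : forall t, tri z t = (t \in [:: x; y]).
  by apply: outer_triE; rewrite // 1?tri_sym // tri_neq.
have u : uniq [:: x; y; z] by rewrite /= !inE negb_or !tri_neq.
have [ix iy iz] : [/\ index x [:: x; y; z] = 0, index y [:: x; y; z] = 1 &
    index z [:: x; y; z] = 2].
  have ind n := @index_uniq _ x n [:: x; y; z] ^~ u.
  by split; [exact: (ind 0)|exact: (ind 1)|exact: (ind 2)].
have cN p q : outer p -> outer q -> tri p q -> c p != c q.
  move=> op oq pq; have [|_ h] := pc (x := p); first by rewrite inE.
  by rewrite eq_sym; apply: h; rewrite // inE.
have [|l12 [l13 [l23 []]]] := @triangle_colors (c x) (c y) (c z).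
  by rewrite /= !inE negb_or !cN.
rewrite /= !inE !negb_or !andbT => /and3P[/and3P[h1 h2 h3] /andP[h4 h5] h6].
move=> /andP[h7 h8] /andP[h9 h10] /andP[h11 h12].
pose M i j : color := match i, j with
  | 0, 1 | 1, 0 => l12 | 0, 2 | 2, 0 => l13 | _, _ => l23 end.
pose f s t := M (index s [:: x; y; z]) (index t [:: x; y; z]).
have [xB yB zB] : let B := [set v in [:: x; y; z]] in [/\ x \in B, y \in B & z \in B].
  by rewrite /= !inE !eqxx !orbT.
exists [set v in [:: x; y; z]], f; split=> //; split.
- move=> s t; rewrite inE !in_cons orbF => /or3P[]/eqP->;
  rewrite ?xE' ?yE ?zE !in_cons !orbF => /orP[]/eqP->; split=> //;
  by rewrite /f ?ix ?iy ?iz.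
- move=> s t r; rewrite inE !in_cons orbF => /or3P[]/eqP->;
  rewrite ?xE' ?yE ?zE !in_cons !orbF => /orP[]/eqP-> /orP[]/eqP->;
  rewrite ?eqxx // /f ?ix ?iy ?iz //= => _; by rewrite // eq_sym.
- move=> s t s' t'; rewrite inE !in_cons orbF => /or3P[]/eqP-> _;
  rewrite ?xE' ?yE ?zE !in_cons !orbF => /orP[]/eqP-> _;
  rewrite /f ?ix ?iy ?iz /= => /eqP;
  by rewrite ?(negbTE h3) ?(negbTE h5) ?(negbTE h6).
Qed.

(** The last clause encodes sparseness: two edges of colour [top] with ends joined by at most two
    steps, through [w], must share an endpoint and hence coincide. *)
Lemma edge_coloring : exists col : G -> G -> color,
  [/\ forall x y, adj x y -> col y x = col x y,
      forall x y z, adj x y -> adj x z -> y != z -> col x y != col x z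
    & forall x y x' y' w, adj x y -> adj x' y' -> col x y = top -> col x' y' = top ->
        (x == w) || adj x w -> (w == x') || adj w x' -> x' = x \/ x' = y].
Proof.
have [B0 /fin_all_exists[f0 hf0]] := fin_all_exists local_exists.
have symC := sym_connect_sym tri_sym.
(* Choosing the data at the canonical representative makes all vertices of a block use the same
   colouring. *)
pose B x := B0 (root tri x); pose f x := f0 (root tri x).
have connBf x y : connect tri x y -> B x = B y /\ f x = f y.
  by rewrite /B /f => /(rootP symC) ->.
have locB x : local_coloring (B x) (f x) by have [] := hf0 (root tri x).
have closedB r s t : s \in B0 r -> connect tri s t -> t \in B0 r.
  move=> + /connectP[p pp ->]; elim: p s pp => //= y p IH s /andP[sy pp] sB.
  by apply: IH => //; have [_ [h _ _]] := hf0 r; case: (h _ _ sB sy).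
have memB x : x \in B x.
  have [rB _] := hf0 (root tri x).
  by apply: closedB rB _; rewrite symC connect_root.
pose col x y := if tri x y then f x x y else c x.
have colo x y : adj x y -> ~~ tri x y -> [/\ outer x, outer y, y = mate x, x = mate y & c y = c x].
  move=> xy nt; have e : ext x y by rewrite /ext xy.
  have e' : ext y x by rewrite ext_sym.
  have ox := ext_outer e; split=> //; rewrite ?(ext_outer e') //; try exact: ext_mateE.
  have [|cm _] := pc (x := x); first by rewrite inE.
  by rewrite (ext_mateE e).
have cN p q : outer p -> outer q -> tri p q -> c p != c q.
  move=> op oq pq; have [|_ h] := pc (x := p); first by rewrite inE.
  by rewrite eq_sym; apply: h; rewrite // inE.
have top_inner (x y : G) : tri x y -> f x x y = top -> ~~ outer x.
  move=> xy e; have [h _ _] := locB x; apply/negP=> ox.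
  by have [_ _ /(_ ox)[_]] := h _ _ (memB x) xy; rewrite e eqxx.
have endI x y : outer x -> tri x y -> ~~ outer y -> diamond_end x.
  by move=> ox xy iy; rewrite /diamond_end ox; apply/existsP; exists y; rewrite xy.
(* the central edge of a diamond is far from every other edge of colour top *)
have mixed (x y x' y' w : G) : tri x y -> f x x y = top -> adj x' y' -> ~~ tri x' y' ->
    c x' = top -> (x == w) || adj x w -> (w == x') || adj w x' -> False.
  move=> xy e xy' nt ct; have ix := top_inner _ _ xy e.
  have [ox' oy' ey' ex' cy'] := colo _ _ xy' nt.
  have : ~~ (diamond_end x' || diamond_end (mate x')).
    by apply: contraTN isT => /(dc ox'); rewrite ct eqxx.
  rewrite negb_or inner_adj // => /andP[nd nd'] /orP[/eqP<-|xw].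
    case/orP=> [/eqP ex|]; first by rewrite ex ox' in ix.
    by rewrite inner_adj // tri_sym => xx'; rewrite (endI _ _ ox' xx' ix) in nd.
  rewrite tri_sym in xw; case/orP=> [/eqP ex|].
    by subst w; rewrite (endI _ _ ox' xw ix) in nd.
  rewrite adj_tri_ext => /orP[wx'|].
    have [ow|iw] := boolP (outer w).
      by have := diamond_endP (endI _ _ ow xw ix) wx'; rewrite ox'.
    by rewrite tri_sym in wx'; rewrite (endI _ _ ox' wx' iw) in nd.
  move=> wx'; have ow := ext_outer wx'; rewrite ext_sym in wx'.
  by rewrite -(ext_mateE wx') (endI _ _ ow xw ix) in nd'.
exists col; split.
- move=> x y xy; rewrite /col tri_sym; case: ifP => t; last first.
    by case: (colo _ _ xy (negbT t)).
  have [_ <-] := connBf _ _ (connect1 t).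
  by have [h _ _] := locB x; case: (h _ _ (memB x) t).
- move=> x y z xy xz nyz; have [h1 h2 _] := locB x.
  rewrite /col; case: ifP => ty; case: ifP => tz.
  + exact: h2.
  + have [ox _ _ _ _] := colo _ _ xz (negbT tz).
    by have [_ _ /(_ ox)[]] := h1 _ _ (memB x) ty.
  + have [ox _ _ _ _] := colo _ _ xy (negbT ty).
    by have [_ _ /(_ ox)[]] := h1 _ _ (memB x) tz; rewrite eq_sym.
  + have [_ _ ey _ _] := colo _ _ xy (negbT ty).
    have [_ _ ez _ _] := colo _ _ xz (negbT tz).
    by rewrite ey ez eqxx in nyz.
- move=> x y x' y' w xy xy'; rewrite /col.
  have [t|nt] := boolP (tri x y); have [t'|nt'] := boolP (tri x' y') => e e' xw wx'.
  (* Every edge at the inner vertices [x] and [x'] lies in a triangle, so the steps through [w] stay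
     in one block, which has at most one edge of colour [top]. *)
  + have ix := top_inner _ _ t e; have ix' := top_inner _ _ t' e'.
    have : connect tri x x'.
      apply: (@connect_trans _ _ w).
        by case/orP: xw => [/eqP-> //|]; rewrite inner_adj //; exact: connect1.
      case/orP: wx' => [/eqP-> //|]; rewrite adj_sym inner_adj // tri_sym.
      exact: connect1.
    move=> /connBf[eB ef]; have [_ _ h] := locB x.
    apply: (h x y x' y'); rewrite // ?memB ?eB ?memB // ef //.
  + by case: (mixed _ _ _ _ _ t e xy' nt' e' xw wx').
  + case: (mixed _ _ _ _ w t' e' xy nt e).
      by rewrite eq_sym adj_sym.
    by rewrite eq_sym adj_sym.
  + have [ox oy ey ex cy] := colo _ _ xy nt.
    have [ox' oy' ey' ex' cy'] := colo _ _ xy' nt'.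
    have nd : ~~ diamond_end x.
      by apply: contraTN isT => d; have := dc ox; rewrite d e eqxx => /(_ isT).
    have sep p q : outer p -> outer q -> c p = top -> c q = top -> tri p q -> False.
      by move=> op oq cp cq /(cN _ _ op oq); rewrite cp cq eqxx.
    case/orP: xw => [/eqP ew|xw].
      subst w; case/orP: wx' => [/eqP->|]; first by left.
      rewrite adj_tri_ext => /orP[t|/ext_mateE->]; last by right; rewrite ey.
      by case: (sep _ _ ox ox' e e' t).
    case/orP: wx' => [/eqP ew|wx'].
      subst w; move: xw; rewrite adj_tri_ext => /orP[t|/ext_mateE->]; last by right; rewrite ey.
      by case: (sep _ _ ox ox' e e' t).
    (* Two proper steps: if one is a triangle edge, two ends of edges coloured [top] fall in a
       common triangle unless [x] equals [x']; two steps outside triangles lead back to [x]. *)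
    move: xw wx'; rewrite ![adj _ _]adj_tri_ext => /orP[xw|xw] /orP[wx'|wx'].
    * have ow := tri_outer ox nd xw; rewrite tri_sym in xw.
      have [->|nxx] := eqVneq x x'; first by left.
      by case: (sep _ _ ox ox' e e'); exact: tri_trans ow xw wx' nxx.
    * have [aw nw] : adj w x' /\ ~~ tri w x' by case/andP: wx'.
      have [ow _ _ _ cw] := colo _ _ aw nw.
      by case: (sep _ _ ox ow e _ xw); rewrite -cw.
    * have ew := ext_mateE xw; rewrite -ey in ew; subst w.
      by case: (sep y x'); rewrite // cy.
    * have ew := ext_mateE xw; rewrite -ey in ew; subst w.
      by left; rewrite (ext_mateE wx') -ex.
Qed.
End Coloring.
End Graph.

(** * Edge-distance expressed through endpoints *)

Lemma edgeE (G : sgraph) (a : edge G) (u : G) : u \in val a ->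
  exists2 y, adj u y & val a = [set u; y].
Proof.
have := valP a; rewrite inE => /existsP[x /existsP[y /andP[xy /eqP ea]]].
rewrite ea !inE => /orP[]/eqP->; first by exists y.
by exists x; [rewrite adj_sym|exact: setUC].
Qed.

Lemma edge_endpoint (G : sgraph) (a : edge G) : exists u, u \in val a.
Proof.
have := valP a; rewrite inE => /existsP[x /existsP[y /andP[xy /eqP ea]]].
by exists x; rewrite ea !inE eqxx.
Qed.

Lemma edge_adj (G : sgraph) (a : edge G) (u v : G) : u \in val a -> v \in val a ->
  (u == v) || adj u v.
Proof.
by move=> /edgeE[y uy ->]; rewrite !inE => /orP[]/eqP->; rewrite ?eqxx // uy orbT.
Qed.

Lemma line_adjP (G : sgraph) (a b : edge G) : line_adj a b ->
  exists2 u, u \in val a & u \in val b.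
Proof. by case/andP=> _ /pred0Pn[u /andP[ua ub]]; exists u. Qed.

(** A line-graph walk of at most three steps has at most two intermediate edges, and consecutive
    edges share a vertex. Shorter walks are padded by repeating vertices. *)
Lemma line_dist_le3 (G : sgraph) (a b : edge G) : a != b ->
  ~~ at_least 4 (edge_dist a b) -> exists u v w,
  [/\ u \in val a, v \in val b, (u == w) || adj u w & (w == v) || adj w v].
Proof.
move=> nab; rewrite /edge_dist; have := distP (G := line_graph G) a b.
case: dist => //= n [/walkP[p [sp pp lp]] _]; rewrite -ltnNge => n4.
case: p sp pp lp n4 => [|e1 [|e2 [|e3 [|e4 p]]]] /= <- //.
- by move=> _ e; rewrite e eqxx in nab.
- rewrite andbT => /line_adjP[u ua u1] <- _.
  by exists u, u, u; rewrite eqxx.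
- move=> /and3P[/line_adjP[u ua u1] /line_adjP[v v1 v2] _] <- _.
  by exists u, v, v; rewrite eqxx (edge_adj u1 v1).
- move=> /and4P[/line_adjP[u ua u1] /line_adjP[w w1 w2] /line_adjP[v v2 v3] _] <- _.
  by exists u, v, w; rewrite (edge_adj u1 w1) (edge_adj w2 v2).
Qed.

Lemma line_dist_le1 (G : sgraph) (a b : edge G) : a != b ->
  ~~ at_least 2 (edge_dist a b) -> exists2 u, u \in val a & u \in val b.
Proof.
move=> nab; rewrite /edge_dist; have := distP (G := line_graph G) a b.
case: dist => //= n [/walkP[p [sp pp lp]] _]; rewrite -ltnNge => n2.
case: p sp pp lp n2 => [|e1 [|e2 p]] /= <- //.
- by move=> _ e; rewrite e eqxx in nab.
- by rewrite andbT => /line_adjP[u ua u1] <- _; exists u.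
Qed.

Theorem theorem1p3 (G : sgraph) (hcubic : cubic G) (hclaw : claw_free G) :
  has_packing_edge_coloring G [:: 1; 1; 1; 3].
Proof.
have closed : mate_closed [set x : G | outer x].
  by move=> x; rewrite !inE => ox; split=> //; apply: outer_mate.
have [c pc dc] := proper_exists hcubic hclaw closed.
have [|col [col_sym col_proper col_far]] := edge_coloring hcubic hclaw pc.
  by move=> x ox; apply: dc; rewrite inE.
(* Binary reading of a colour: [top] becomes index 3, the position of the entry 3 in the
   sequence. *)
pose code (k : bool * bool) : 'I_4 := inord (k.1.*2 + k.2).
have code_val k : code k = k.1.*2 + k.2 :> nat by rewrite inordK //; case: k => [[] []].
have code_inj k l : code k = code l -> k = l.
  by move=> /(congr1 val) /=; rewrite !code_val; move: k l => [[] []] [[] []].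
(* An edge is an unordered pair, so both orientations are tested; they agree by the symmetry of
   [col]. *)
pose E (i : 'I_4) := [set a : edge G | [forall x, forall y,
  (adj x y && (val a == [set x; y])) ==> (code (col x y) == i)]].
have EP i a x y : a \in E i -> adj x y -> val a = [set x; y] -> code (col x y) = i.
  rewrite inE => /forallP/(_ x)/forallP/(_ y)/implyP h xy e.
  by apply/eqP/h; rewrite xy e eqxx.
have same (a b : edge G) u y z : adj u y -> adj u z -> val a = [set u; y] ->
    val b = [set u; z] -> col u y = col u z -> a = b.
  move=> uy uz ea eb cyz; apply: val_inj; rewrite ea eb.
  by have [-> //|/(col_proper _ _ _ uy uz)] := eqVneq y z; rewrite cyz eqxx.
exists E; split.
- apply/setP=> a; rewrite [RHS]inE; apply/bigcupP.
  have [u ua] := edge_endpoint a; have [y uy ea] := edgeE ua.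
  exists (code (col u y)) => //; rewrite inE; apply/forallP=> x'; apply/forallP=> y'.
  apply/implyP=> /andP[xy' /eqP ea'].
  have : x' \in [set u; y] by rewrite -ea ea' !inE eqxx.
  have : y' \in [set u; y] by rewrite -ea ea' !inE eqxx orbT.
  rewrite !inE => /orP[]/eqP ey /orP[]/eqP ex; move: xy'; rewrite ex ey ?adj_irrefl //.
  by rewrite (col_sym _ _ uy).
- move=> i j; apply: contraR => /pred0Pn[a /andP[/= ai aj]].
  have [u ua] := edge_endpoint a; have [y uy ea] := edgeE ua.
  by rewrite -(EP _ _ _ _ ai uy ea) -(EP _ _ _ _ aj uy ea).
- move=> i a b ai bi nab.
  have far3 : i = 3 :> nat -> at_least 4 (edge_dist a b).
    move=> i3; apply: contraNT nab => h; apply/eqP; have [eab|nab] := eqVneq a b => //.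
    have [u [v [w [ua vb uw wv]]]] := line_dist_le3 nab h.
    have [y uy ea] := edgeE ua; have [z vz eb] := edgeE vb.
    have top_col x' y' e : e \in E i -> adj x' y' -> val e = [set x'; y'] ->
        col x' y' = (true, true).
      move=> eE xy' ee; apply: code_inj; apply: val_inj.
      by rewrite (EP _ _ _ _ eE xy' ee) /= i3 code_val.
    have cy := top_col _ _ _ ai uy ea; have cz := top_col _ _ _ bi vz eb.
    case: (col_far _ _ _ _ _ uy vz cy cz uw wv) => e; subst v.
      by apply: (same _ _ _ _ _ uy vz ea eb); rewrite cy.
    have yu : adj y u by rewrite adj_sym.
    rewrite setUC in ea; apply: (same _ _ _ _ _ yu vz ea eb).
    by rewrite (col_sym _ _ uy) cy.
  have far1 : at_least 2 (edge_dist a b).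
    apply: contraNT nab => h; apply/eqP; have [eab|nab] := eqVneq a b => //.
    have [u ua ub] := line_dist_le1 nab h.
    have [y uy ea] := edgeE ua; have [z uz eb] := edgeE ub.
    apply: (same _ _ _ _ _ uy uz ea eb); apply: code_inj.
    by rewrite (EP _ _ _ _ ai uy ea) (EP _ _ _ _ bi uz eb).
  by case: i ai bi far3 => [[|[|[|[|i]]]] lt_i] //= _ _ /(_ erefl).
Qed.
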